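(* Let $(G,\tau,\partial)$ be a Polish topometric group with ample generics. Then $G$ is Steinhaus with exponent $10$: whenever $A\subseteq G$ is symmetric and $\sigma$-syndetic, $1_G\in\mathrm{Int}_\tau\big((A^{10})_\varepsilon\big)$ for every $\varepsilon>0$.
   Context: A Polish topometric group is a triple $(G,\tau,\partial)$ with $(G,\tau)$ a Polish group, $\partial$ a bi-invariant metric (not necessarily separable) whose topology refines $\tau$ and which is $\tau$-lower semi-continuous ($\{(x,y)\colon\partial(x,y)\le r\}$ is $\tau$-closed for all $r$). For $A\subseteq G$, $(A)_\varepsilon=\{g\colon\partial(g,A)<\varepsilon\}$. $G^n$ has the product topology and supremum metric, and $G$ acts on $G^n$ by diagonal conjugation. $(G,\tau,\partial)$ has ample generics if for all $n\in\mathbb N$ and $\varepsilon>0$ there is $\bar g\in G^n$ with $(\{(kg_0k^{-1},\dots,kg_{n-1}k^{-1})\colon k\in G\})_\varepsilon$ co-meagre in $G^n$. A subset $A$ of a group $G$ is $\sigma$-syndetic if $G$ is covered by countably many left translates of $A$. Interiors are taken with respect to $\tau$. *)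

(* Defs.v *)
From HB Require Import structures.
From mathcomp Require Import all_boot all_order all_algebra.
From mathcomp Require Import all_classical all_reals all_analysis.
From mathcomp Require Import Rstruct Rstruct_topology.
From Stdlib Require Import Rdefinitions.

Set Implicit Arguments.
Unset Strict Implicit.
Unset Printing Implicit Defensive.

Import Order.TTheory GRing.Theory Num.Theory.
Local Open Scope classical_set_scope.
Local Open Scope ring_scope.

Definition group_axioms (G : Type) (mul : G -> G -> G) (inv : G -> G) (one : G) :=
  [/\ forall x y z, mul x (mul y z) = mul (mul x y) z,
      forall x, mul one x = x /\ mul x one = x &
      forall x, mul (inv x) x = one /\ mul x (inv x) = one].

Definition topological_group (G : topologicalType)
    (mul : G -> G -> G) (inv : G -> G) (one : G) :=
  group_axioms mul inv one /\
  continuous (fun p : G * G => mul p.1 p.2) /\ continuous inv.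

Definition is_metric (T : Type) (d : T -> T -> R) :=
  [/\ forall x y, 0 <= d x y,
      forall x y, d x y = 0 <-> x = y,
      forall x y, d x y = d y x &
      forall x y z, d x z <= d x y + d y z].

Definition polish_space (T : topologicalType) :=
  (exists D : set T, countable D /\ dense D) /\
  exists d : T -> T -> R,
    [/\ is_metric d,
        forall (x : T) (U : set T),
          nbhs x U <-> exists2 r : R, 0 < r & [set y | d x y < r] `<=` U &
        forall u : nat -> T,
          (forall e : R, 0 < e -> exists N : nat,
             forall m n : nat, leq N m -> leq N n -> d (u m) (u n) < e) ->
          exists l : T, u @ \oo --> l].

Definition polish_group (G : topologicalType)
    (mul : G -> G -> G) (inv : G -> G) (one : G) :=
  topological_group mul inv one /\ polish_space G.

Definition polish_topometric_group (G : topologicalType)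
    (mul : G -> G -> G) (inv : G -> G) (one : G) (d : G -> G -> R) :=
  [/\ polish_group mul inv one,
      is_metric d,
      (forall g x y, d (mul g x) (mul g y) = d x y /\
                     d (mul x g) (mul y g) = d x y),
      (forall U : set G, open U -> forall x, U x ->
         exists2 r : R, 0 < r & [set y | d x y < r] `<=` U) &
      forall r : R, closed [set p : G * G | d p.1 p.2 <= r]].

Definition nowhere_dense (T : topologicalType) (S : set T) :=
  (closure S)° = set0.

Definition meagre (T : topologicalType) (S : set T) :=
  exists F : nat -> set T, (forall i, nowhere_dense (F i)) /\
    S `<=` \bigcup_i F i.

Definition comeagre (T : topologicalType) (S : set T) := meagre (~` S).

(** (A)_eps = { g | d(g, A) < eps }, d(g,A) = inf_{a in A} d(g,a). *)
Definition fatten (T : Type) (d : T -> T -> R) (A : set T) (eps : R) : set T :=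
  [set g | exists2 a, A a & d g a < eps].

Definition sup_metric (T : Type) (d : T -> T -> R) (n : nat)
    (x y : 'I_n -> T) : R :=
  \big[Num.max/0]_(i < n) d (x i) (y i).

Definition conj_orbit (G : Type) (mul : G -> G -> G) (inv : G -> G)
    (n : nat) (g : 'I_n -> G) : set ('I_n -> G) :=
  [set h | exists k : G, h = fun i => mul (mul k (g i)) (inv k)].

(** Ample generics; G^n carries the product topology {ptws 'I_n -> G}. *)
Definition ample_generics (G : topologicalType)
    (mul : G -> G -> G) (inv : G -> G) (d : G -> G -> R) :=
  forall (n : nat) (eps : R), 0 < eps ->
    exists g : 'I_n -> G,
      comeagre (fatten (@sup_metric G d n) (conj_orbit mul inv g) eps
                : set {ptws 'I_n -> G}).

Definition prodset (G : Type) (mul : G -> G -> G) (A B : set G) : set G :=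
  [set x | exists a b, [/\ A a, B b & x = mul a b]].

Fixpoint setpow (G : Type) (mul : G -> G -> G) (one : G) (A : set G) (k : nat)
    : set G :=
  match k with
  | 0%N => [set one]
  | k'.+1 => prodset mul (setpow mul one A k') A
  end.

Definition symmetric_set (G : Type) (inv : G -> G) (A : set G) :=
  forall a, A a <-> A (inv a).

Definition sigma_syndetic (G : Type) (mul : G -> G -> G) (A : set G) :=
  exists g : nat -> G, forall x, exists i, exists2 a, A a & x = mul (g i) a.

(* Main.v *)
(** If [A] is nonmeagre at every point of the nonempty open set [O], then [A]
    and [g A] are both nonmeagre at every point of [O ∩ g O], which is nonempty
    for [g] near [1].  Ample generics then yield a tree of conjugators [h a],
    [a : nat -> bool], such that for any two distinct branches [h a] and [h b]
    carry some [x ∈ A] and some [g y ∈ g A] within [eps] of each other by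
    conjugation.  As countably many translates of [A] cover the group, two
    branches lie in the same [k A], so that [g] is within [eps] of
    [A^2 x A^2 y^-1 ⊆ A^6 ⊆ A^10].

    As [A] need not have the Baire property, the conjugators must work for almost
    all elements of an open set; this is where it is needed that projections of
    closed sets have the Baire property. *)

Require Import Defs.
From HB Require Import structures.
From mathcomp Require Import all_boot all_order all_algebra.
From mathcomp Require Import all_classical all_reals all_analysis.
From mathcomp Require Import Rstruct Rstruct_topology.
From mathcomp Require Import lra.
From Stdlib Require Import Rdefinitions.
Set Implicit Arguments.
Unset Strict Implicit.
Unset Printing Implicit Defensive.

Import Order.TTheory GRing.Theory Num.Theory.
Local Open Scope classical_set_scope.
Local Open Scope ring_scope.
Delimit Scope nat_scope with N.

(** * Meagre and nowhere dense sets *)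

Section MeagreSets.
Variable T : topologicalType.
Implicit Types (S U : set T).

Lemma nowhere_denseP S :
  nowhere_dense S <->
  forall U, open U -> U !=set0 -> exists2 x, U x & ~ closure S x.
Proof.
rewrite /nowhere_dense; split => [S0 U oU [u Uu]|h].
  apply: contrapT => h; have : (closure S)° u.
    apply: (filterS _ (open_nbhs_nbhs (conj oU Uu))) => x Ux.
    by apply: contrapT => ?; apply: h; exists x.
  by rewrite S0.
rewrite -subset0 => x Sx.
have [|y /interior_subset Sy //] := h _ (@open_interior _ (closure S)).
by exists x.
Qed.

Lemma nowhere_dense_meagre S : nowhere_dense S -> meagre S.
Proof. by move=> S0; exists (fun=> S); split=> // x Sx; exists 0%N. Qed.

Lemma nowhere_dense0 : nowhere_dense (set0 : set T).
Proof. by rewrite /nowhere_dense closure0 interior0. Qed.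

Lemma meagre0 : meagre (set0 : set T).
Proof. exact/nowhere_dense_meagre/nowhere_dense0. Qed.

Lemma meagreS S1 S2 : S1 `<=` S2 -> meagre S2 -> meagre S1.
Proof.
by move=> S12 [F [F0 S2F]]; exists F; split=> //; exact: subset_trans S2F.
Qed.

Lemma meagre_bigcup (I : countType) (F : I -> set T) :
  (forall i, meagre (F i)) -> meagre (\bigcup_i F i).
Proof.
move=> /choice[G GP].
pose H n := if @unpickle (I * nat)%type n is Some (i, k) then G i k else set0.
exists H; split=> [n|x [i _ /(GP i).2[k _ Gx]]].
  rewrite /H; case: unpickle => [[i k]|]; first exact: (GP i).1.
  exact: nowhere_dense0.
by exists (pickle (i, k)) => //; rewrite /H pickleK.
Qed.

Lemma meagreU S1 S2 : meagre S1 -> meagre S2 -> meagre (S1 `|` S2).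
Proof.
move=> m1 m2; have : meagre (\bigcup_(b : bool) if b then S1 else S2).
  by apply: meagre_bigcup => -[].
by apply: meagreS => x [] ?; [exists true|exists false].
Qed.

Lemma meagre_closed_diff U : open U -> meagre (closure U `\` U).
Proof.
move=> oU; apply/nowhere_dense_meagre/nowhere_denseP => V oV [v Vv].
have [[w [Uw Vw]]|UV] := pselect (U `&` V !=set0).
  exists w => // /(_ _ (open_nbhs_nbhs (conj oU Uw))) [z [[_ nUz]]].
  by [].
exists v => // /(_ _ (open_nbhs_nbhs (conj oV Vv))) [z [[cUz _] Vz]].
have [t [Ut Vt]] := cUz _ (open_nbhs_nbhs (conj oV Vz)).
by apply: UV; exists t.
Qed.

Lemma meagre_closed_interior S : closed S -> meagre (S `\` S°).
Proof.
move=> cS; apply/nowhere_dense_meagre/nowhere_denseP => V oV [v Vv].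
have cl : closure (S `\` S°) `<=` S `\` S°.
  rewrite setDE.
  by apply: closedI => //; apply: open_closedC; exact: open_interior.
have [Sv|] := pselect (S° v); last first.
  move=> nSv; apply: contrapT => h; apply: nSv.
  apply: (filterS _ (open_nbhs_nbhs (conj oV Vv))) => w Vw.
  by apply: contrapT => nSw; apply: h; exists w => // /cl[].
by exists v => // /cl [].
Qed.

End MeagreSets.

Lemma meagre_preimage (T T' : topologicalType) (f : T -> T') (g : T' -> T)
    (S : set T') : continuous f -> continuous g -> cancel g f ->
  cancel f g -> meagre S -> meagre (f @^-1` S).
Proof.
move=> cf cg gK fK [F [F0 SF]]; exists (fun i => f @^-1` F i).
split=> [i|x /SF [i _ Fi]]; last by exists i.
apply/nowhere_denseP => U oU [u Uu].
have [||y Uy Fy] := (nowhere_denseP (F i)).1 (F0 i) (g @^-1` U).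
- by move/continuousP: cg; apply.
- by exists (f u); rewrite /= fK.
exists (g y) => // cFy; apply: Fy => V yV.
have := cFy (f @^-1` V); case.
  by apply: cf; rewrite gK.
by move=> x [Fx Vx]; exists (f x).
Qed.

(** * Points at which a set is nonmeagre *)

Definition countable_base (T : topologicalType) (B : nat -> set T) :=
  (forall i, open (B i)) /\
  forall (x : T) (U : set T), open U -> U x ->
    exists i, B i x /\ B i `<=` U.

Definition nonmeagre_points (T : topologicalType) (S : set T) : set T :=
  [set x | forall U, open U -> U x -> ~ meagre (S `&` U)].

Section NonmeagrePoints.
Variables (T : topologicalType) (B : nat -> set T).
Hypothesis Bb : countable_base B.
Implicit Types S U : set T.
Local Notation N := (@nonmeagre_points T).

Lemma nonmeagre_pointsS S1 S2 : S1 `<=` S2 -> N S1 `<=` N S2.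
Proof.
move=> S12 x Nx U oU Ux mU; apply: (Nx U) => //.
by apply: meagreS mU; exact: setSI.
Qed.

(** A form of the Banach category theorem: with a countable base, only the countably many meagre
    traces of [S] on basic sets have to be collected. *)
Lemma meagre_diff_nonmeagre_points S : meagre (S `\` N S).
Proof.
pose F i := if pselect (meagre (S `&` B i)) then S `&` B i else set0.
have : meagre (\bigcup_i F i).
  by apply: meagre_bigcup => i; rewrite /F; case: pselect => [//|nm]; exact: meagre0.
apply: meagreS => x [Sx nNx].
have [U [oU Ux mU]] : exists U, [/\ open U, U x & meagre (S `&` U)].
  apply: contrapT => h; apply: nNx => U oU Ux mU.
  by apply: h; exists U.
have [i [Bx BU]] := Bb.2 _ _ oU Ux.
exists i => //; rewrite /F; case: pselect => // -[].
by apply: meagreS mU; exact: setIS.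
Qed.

Lemma closed_nonmeagre_points S : closed (N S).
Proof.
move=> x cx U oU Ux.
have [y [Ny Uy]] := cx _ (open_nbhs_nbhs (conj oU Ux)).
exact: Ny.
Qed.

Lemma nonmeagre_interior S : ~ meagre S -> (N S)° !=set0.
Proof.
move=> nS; apply: contrapT => h; apply: nS.
have : meagre ((S `\` N S) `|` (N S `\` (N S)°)).
  apply: meagreU; first exact: meagre_diff_nonmeagre_points.
  exact/meagre_closed_interior/closed_nonmeagre_points.
apply: meagreS => x Sx; have [Nx|nNx] := pselect (N S x); [right|left] => //.
by split=> // ix; apply: h; exists x.
Qed.

Lemma nonmeagre_diff S M U : U `<=` N S -> open U -> U !=set0 ->
  meagre M -> exists2 x, U x & S x /\ ~ M x.
Proof.
move=> UN oU [u Uu] mM; apply: contrapT => h.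
apply: (UN u Uu U oU Uu); apply: meagreS mM => x [Sx Ux].
by apply: contrapT => nMx; apply: h; exists x.
Qed.

(** Outside the closure of [V] every [F i] is meagre, up to the boundary of [N (F i)], and so is
    their union [S]. Hence the interior of [N S] lies in the closure of [V], and the exceptional
    points lie in the boundary of [N S] or of [V]. *)
Lemma nonmeagre_points_bigcup (F : nat -> set T) :
  meagre (N (\bigcup_i F i) `\` \bigcup_i N (F i)).
Proof.
set S := \bigcup_i _.
pose V := \bigcup_i (N (F i))°.
have oV : open V by apply: bigcup_open => i _; exact: open_interior.
have : meagre ((N S `\` (N S)°) `|` (closure V `\` V)).
  apply: meagreU; first exact/meagre_closed_interior/closed_nonmeagre_points.
  exact: meagre_closed_diff.
apply: meagreS => x [NSx nFx].
have [iS|] := pselect ((N S)° x); last by left.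
right; split; last first.
  by move=> [i _ /interior_subset Nix]; apply: nFx; exists i.
apply: contrapT => nVx.
apply: (NSx (~` closure V)) => //.
  by apply: closed_openC; exact: closed_closure.
have : meagre (\bigcup_i ((F i `\` N (F i)) `|` (N (F i) `\` (N (F i))°))).
  apply: meagre_bigcup => i; apply: meagreU.
    exact: meagre_diff_nonmeagre_points.
  exact/meagre_closed_interior/closed_nonmeagre_points.
apply: meagreS => y [[i _ Fiy] ncVy]; exists i => //.
have [Ny|nNy] := pselect (N (F i) y); [right|left] => //; split=> //.
by move=> iy; apply: ncVy; apply: subset_closure; exists i.
Qed.

End NonmeagrePoints.

(** * Complete metrics, the Baire category theorem, projections of closed sets *)

Lemma exprn_half_lt (e : R) : 0 < e -> exists n : nat, 2^-1 ^+ n < e :> R.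
Proof.
move=> e0; pose n := Num.bound e^-1; exists n.
rewrite exprVn invf_plt ?posrE ?exprn_gt0 //.
apply: lt_trans (archi_boundP _) _; first by rewrite invr_ge0 ltW.
by rewrite -natrX ltr_nat ltn_expl.
Qed.

Lemma exprn_half_le (m n : nat) : (m <= n)%N -> 2^-1 ^+ n <= 2^-1 ^+ m :> R.
Proof. by move=> mn; apply: ler_wiXn2l => //; lra. Qed.

(** The body of the existential over metrics in [polish_space], so that one witness can be fixed
    throughout. *)
Definition complete_metric_for (T : topologicalType) (rho : T -> T -> R) :=
  [/\ is_metric rho,
      forall (x : T) (U : set T),
        nbhs x U <-> exists2 r : R, 0 < r & [set y | rho x y < r] `<=` U &
      forall u : nat -> T,
        (forall e : R, 0 < e -> exists N : nat,
           forall m n : nat, leq N m -> leq N n -> rho (u m) (u n) < e) ->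
        exists l : T, u @ \oo --> l].

Definition dense_sequence (T : topologicalType) (q : nat -> T) :=
  forall U : set T, open U -> U !=set0 -> exists i, U (q i).

(** The sequence inverts an injection of [D] into [nat], with [x0] as value off its range; this
    covers finite [D] too. *)
Lemma countable_dense_sequence (T : topologicalType) (x0 : T) (D : set T) :
  countable D -> dense D -> exists q : nat -> T, dense_sequence q.
Proof.
move=> /countable_injP[f finj] dD.
have /choice[q qP] : forall i : nat, exists x, forall y, D y -> f y = i -> x = y.
  move=> i; have [[y [Dy fy]]|h] := pselect (exists y, D y /\ f y = i).
    exists y => z Dz fz; apply: finj; rewrite ?inE //.
    by rewrite fy.
  by exists x0 => y Dy fy; case: h; exists y.
exists q => U oU U0; have [y [Uy Dy]] := dD _ U0 oU.
by exists (f y); rewrite (qP _ y Dy erefl).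
Qed.

Section CompleteMetric.
Variables (T : topologicalType) (rho : T -> T -> R).
Hypothesis rhoP : complete_metric_for rho.

Let rho_xx x : rho x x = 0. Proof. by case: rhoP => -[_ /(_ x x)[_ ->]]. Qed.
Let rho_sym x y : rho x y = rho y x. Proof. by case: rhoP => -[]. Qed.
Let rho_tri y x z : rho x z <= rho x y + rho y z.
Proof. by case: rhoP => -[]. Qed.
Let rho_nbhs x U :
  nbhs x U <-> exists2 r : R, 0 < r & [set y | rho x y < r] `<=` U.
Proof. by case: rhoP. Qed.

Lemma metric_ball_nbhs x (r : R) : 0 < r -> nbhs x [set y | rho x y < r].
Proof. by move=> r0; apply/rho_nbhs; exists r. Qed.

Lemma open_metric_ball x (r : R) : open [set y | rho x y < r].
Proof.
rewrite openE => y /= xy; apply/rho_nbhs; exists (r - rho x y).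
  by rewrite subr_gt0.
by move=> z /= yz; have := rho_tri y x z; lra.
Qed.

Lemma closed_metric_ball x (r : R) : closed [set y | rho x y <= r].
Proof.
move=> y cy /=; rewrite leNgt; apply/negP => ry.
have [z /= [xz yz]] :
    [set y | rho x y <= r] `&` [set z | rho y z < rho x y - r] !=set0.
  by apply: cy; apply: metric_ball_nbhs; rewrite subr_gt0.
by have := rho_tri z x y; rewrite (rho_sym z); lra.
Qed.

Lemma geometric_dist (u : nat -> T) n k :
  (forall n, rho (u n) (u n.+1) < 2^-1 ^+ n) ->
  rho (u n) (u (n + k)%N) <= 2 * 2^-1 ^+ n.
Proof.
move=> hu; elim: k n => [|k IH] n.
  by rewrite addn0 rho_xx mulr_ge0 // exprn_ge0.
have := IH n.+1; rewrite addSnnS exprS => h.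
by have := rho_tri (u n.+1) (u n) (u (n + k.+1)%N); have := hu n; lra.
Qed.

Lemma geometric_cvg (u : nat -> T) :
  (forall n, rho (u n) (u n.+1) < 2^-1 ^+ n) -> exists l : T, u @ \oo --> l.
Proof.
move=> hu; case: rhoP => _ _; apply => e e0.
have [N hN] := exprn_half_lt (divr_gt0 e0 (ltr0Sn _ 3)).
exists N => m n Nm Nn.
have := @geometric_dist u N (m - N) hu; have := @geometric_dist u N (n - N) hu.
rewrite !subnKC // => h1 h2; have := rho_tri (u N) (u m) (u n).
by rewrite (rho_sym (u m) (u N)); lra.
Qed.

Lemma dense_sequence_countable_base (q : nat -> T) :
  dense_sequence q -> exists B : nat -> set T, countable_base B.
Proof.
move=> qd.
exists (fun n => if @unpickle (nat * nat)%type n is Some (i, k)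
                 then [set y | rho (q i) y < 2^-1 ^+ k] else set0).
split=> [n|x U oU Ux].
  by case: unpickle => [[i k]|]; [exact: open_metric_ball|exact: open0].
have /rho_nbhs[r r0 rU] := open_nbhs_nbhs (conj oU Ux).
have [k hk] := exprn_half_lt (divr_gt0 r0 (ltr0Sn _ 1)).
have k0 : 0 < 2^-1 ^+ k :> R by apply: exprn_gt0.
have [i /= xqi] := qd _ (open_metric_ball x (2^-1 ^+ k))
  ltac:(by exists x; rewrite /= rho_xx).
exists (pickle (i, k)); rewrite pickleK /=; split; first by rewrite rho_sym.
move=> y /= qy; apply: rU => /=.
by have := rho_tri (q i) x y; lra.
Qed.

Lemma baire_category (U : set T) : open U -> U !=set0 -> ~ meagre U.
Proof.
move=> oU [x0 Ux0] [F [F0 UF]].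
(* Positivity of the old radius is assumed inside the existential, so that [choice] gives a total
   function on centres and radii. *)
have step : forall (nc : nat * (T * R)), exists c' : T * R, 0 < nc.2.2 ->
    [/\ 0 < c'.2, c'.2 <= 2^-1 ^+ nc.1.+1, rho nc.2.1 c'.1 < nc.2.2 &
        forall y, rho c'.1 y <= c'.2 -> rho nc.2.1 y <= nc.2.2 /\ ~ F nc.1 y].
  move=> [n [c r]] /=.
  have [r0|nr0] := pselect (0 < r); last by exists (c, r).
  have [] := (nowhere_denseP (F n)).1 (F0 n) _ (open_metric_ball c r).
    by exists c; rewrite /= rho_xx.
  move=> c' /= cc' nF.
  have /rho_nbhs[r1 r10 r1F] : nbhs c' (~` closure (F n)).
    apply: open_nbhs_nbhs; split => //.
    by apply: closed_openC; exact: closed_closure.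
  (* The three bounds give, in order, convergence of the centres, a closed ball off [F n], and
     nesting in the previous ball. *)
  exists (c', Num.min (2^-1 ^+ n.+1) (Num.min (r1 / 2) (r - rho c c'))) => _ /=.
  have h0 : 0 < 2^-1 ^+ n.+1 :> R by apply: exprn_gt0.
  split => //.
  - by rewrite !lt_min h0 subr_gt0 cc' andbT /= divr_gt0 //; exact: r0.
  - by rewrite ge_min lexx.
  move=> y; rewrite !le_min => /and3P[_ h1 h2]; split.
    by have := rho_tri c' c y; lra.
  by move=> Fy; apply: (r1F y) => /=; [lra|exact: subset_closure].
have [f fP] := choice step.
have /rho_nbhs[r rp rU] := open_nbhs_nbhs (conj oU Ux0).
(* The limit is only known to lie in the closed balls; radius at most [r / 2] still puts it in [U].
   The bound [1] starts the geometric estimate. *)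
pose s := fix s (n : nat) : T * R := if n is n'.+1 then f (n', s n')
                     else (x0, Num.min 1 (r / 2)).
have s0 n : 0 < (s n).2 /\ (s n).2 <= 2^-1 ^+ n.
  elim: n => [|n [IH _]] /=; last first.
    by have [h1 h2 _ _] := fP (n, s n) IH; exact: (conj h1 h2).
  by rewrite expr0 lt_min ge_min lexx (divr_gt0 rp (ltr0Sn _ 1)) ltr01.
have sS n : rho (s n).1 (s n.+1).1 < (s n).2 /\
    (forall y, rho (s n.+1).1 y <= (s n.+1).2 ->
      rho (s n).1 y <= (s n).2 /\ ~ F n y).
  by have [] := fP (n, s n) (s0 n).1.
have [l cl] := @geometric_cvg (fun n => (s n).1)
  (fun n => lt_le_trans (sS n).1 (s0 n).2).
have inb n k y : rho (s (n + k)%N).1 y <= (s (n + k)%N).2 ->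
    rho (s n).1 y <= (s n).2.
  elim: k => [|k IH]; rewrite ?addn0 // addnS => /(sS _).2[h _].
  exact: IH.
have inl n : rho (s n).1 l <= (s n).2.
  apply: (closed_cvg _ (@closed_metric_ball (s n).1 (s n).2) _ _ cl).
  exists n => // m /= nm; apply: (inb _ (m - n)%N); rewrite subnKC //.
  by rewrite rho_xx ltW //; exact: (s0 m).1.
have /UF [n _] : U l.
  apply: rU => /=; have := inl 0%N; rewrite /= le_min => /andP[_].
  by lra.
by have [_] := (sS n).2 l (inl n.+1).
Qed.

End CompleteMetric.

(* The Souslin scheme [K s] refines the complete factor into sets of vanishing
   diameter; outside a meagre set, a point at which the projection is nonmeagre
   can be followed along a branch of the scheme, and completeness together with
   closedness yields a preimage over it. *)
Lemma projection_nonmeagre_points (P X : topologicalType) (rho : P -> P -> R)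
    (q : nat -> P) (B : nat -> set X) (C : P -> X -> Prop) :
  complete_metric_for rho -> dense_sequence q -> countable_base B ->
  closed [set px : P * X | C px.1 px.2] ->
  let S := [set x | exists p, C p x] in
  meagre (nonmeagre_points S `\` S).
Proof.
move=> rhoP qd Bb cC S.
have [[_ rho0 rho_sym rho_tri] rho_nbhs _] := rhoP.
(* Indices are listed newest first, so a child of [s] is [i :: s]. *)
pose K := fix K (s : seq nat) : set P := if s is i :: s' then
  K s' `&` [set p | rho (q i) p < 2^-1 ^+ (size s).+1] else setT.
pose proj (A : set P) := [set x | exists2 p, A p & C p x].
pose N s := nonmeagre_points (proj (K s)).
have : meagre (\bigcup_s (N s `\` \bigcup_i N (i :: s))).
  apply: meagre_bigcup => s.
  have Ks : proj (K s) = \bigcup_i proj (K (i :: s)).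
    apply/seteqP; split=> [x [p Kp Cp]|x [i _ [p [Kp _] Cp]]]; last by exists p.
    have h0 : 0 < 2^-1 ^+ (size s).+2 :> R by apply: exprn_gt0.
    have [i /= qi] := qd _ (open_metric_ball rhoP p (2^-1 ^+ (size s).+2))
      ltac:(by exists p; rewrite /= (rho0 p p).2).
    by exists i => //; exists p => //; split => //=; rewrite rho_sym.
  by rewrite /N {1}Ks; exact: nonmeagre_points_bigcup Bb _.
apply: meagreS => x [Nx nSx]; apply: contrapT => nM; apply: nSx.
(* Off the meagre set, nonmeagreness at [x] passes from [s] to some child. *)
have step (s : seq nat) : exists i, N s x -> N (i :: s) x.
  have [Nsx|nN] := pselect (N s x); last by exists 0%N.
  apply: contrapT => h; apply: nM; exists s => //; split => // -[i _ Nix].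
  by apply: h; exists i.
have [f fP] := choice step.
pose b := fix b n := if n is n'.+1 then f (b n') :: b n' else [::].
have sb n : size (b n) = n by elim: n => //= n ->.
have Nb n : N (b n) x.
  elim: n => [|n IH]; last exact: fP.
  apply: nonmeagre_pointsS Nx => y [p Cp]; by exists p.
have meet n (U : set X) : open U -> U x ->
    exists p y, [/\ K (b n) p, U y & C p y].
  move=> oU Ux; apply: contrapT => h; apply: (Nb n U oU Ux).
  suff -> : proj (K (b n)) `&` U = set0 by exact: meagre0.
  by rewrite -subset0 => y [[p Kp Cp] Uy]; apply: h; exists p, y.
have /choice[u uP] : forall n, exists p, K (b n.+1) p.
  by move=> n; have [p [y []]] := meet n.+1 setT openT I; exists p.
have Kd n p p' : K (b n.+1) p -> K (b n.+1) p' -> rho p p' < 2^-1 ^+ n.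
  rewrite /= => -[_ +] [_]; rewrite /= sb => h1 h2.
  have := rho_tri p (q (f (b n))) p'; rewrite (rho_sym p (q _)).
  have : 0 < 2^-1 ^+ n :> R by apply: exprn_gt0.
  by move: h1 h2; rewrite !exprS; lra.
have [l cl] : exists l : P, u @ \oo --> l.
  apply: (geometric_cvg rhoP) => n; apply: Kd => //.
  by have [] := uP n.+1.
(* It suffices that [(l, x)] is in the closure: deep pieces of the branch are close to [l], and
   [meet] gives pairs in [C] over points near [x]. *)
exists l; apply: (cC (l, x)) => W [[V1 V2] /= [nV1 nV2] VW].
have [r r0 rV1] := (rho_nbhs _ _).1 nV1.
have [n0 hn0] := exprn_half_lt (divr_gt0 r0 (ltr0Sn _ 1)).
have [n1 _ hn1] := cl _ (metric_ball_nbhs rhoP l (divr_gt0 r0 (ltr0Sn _ 1))).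
pose n := maxn n0 n1.
have [p [y [Kp Uy Cp]]] := meet n.+1 _ (@open_interior _ V2) nV2.
exists (p, y); split => //=; apply: VW; split => /=; last exact: interior_subset.
apply: rV1 => /=.
have := Kd _ _ _ (uP n) Kp; have := @exprn_half_le n0 n (leq_maxl _ _).
have /= := hn1 n (leq_maxr _ _); have := rho_tri l (u n) p.
by lra.
Qed.

(** * Finite powers and the Kuratowski-Ulam theorem *)

Lemma continuous_ptws (S : topologicalType) (I : Type) (T : topologicalType)
    (f : S -> {ptws I -> T}) :
  (forall i, continuous (fun s => f s i)) -> continuous f.
Proof.
move=> cf s; apply/cvg_sup => i.
exact: (@continuous_comp_initial _ _ _ (fun u : {ptws I -> T} => u i) f (cf i)).
Qed.

(** The space of 0-tuples is a single point, where only the empty set is nowhere dense. *)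
Lemma ptws0_comeagre (T : topologicalType) (S : set {ptws 'I_0 -> T})
    (u : {ptws 'I_0 -> T}) : comeagre S -> S u.
Proof.
move=> [F [F0 SF]]; apply: contrapT => /SF [i _ Fu].
have [|w _] := (nowhere_denseP (F i)).1 (F0 i) setT openT; first by exists u.
apply; suff -> : w = u by exact: subset_closure.
by apply/funext => -[].
Qed.

Section Extension.
Variable T : topologicalType.

Definition tuple_ext n (u : {ptws 'I_n -> T}) (x : T) : {ptws 'I_n.+1 -> T} :=
  fun i => if unlift ord_max i is Some j then u j else x.

Lemma tuple_ext_max n (u : {ptws 'I_n -> T}) x : tuple_ext u x ord_max = x.
Proof. by rewrite /tuple_ext unlift_none. Qed.

Lemma tuple_ext_lift n (u : {ptws 'I_n -> T}) x j :
  tuple_ext u x (lift ord_max j) = u j.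
Proof. by rewrite /tuple_ext liftK. Qed.

Lemma tuple_ext_cases n (u : {ptws 'I_n -> T}) (v : {ptws 'I_n.+1 -> T}) :
  (forall j, v (lift ord_max j) = u j) -> v = tuple_ext u (v ord_max).
Proof.
move=> vu; apply/funext => i; rewrite /tuple_ext.
by case: unliftP => [j|] ->.
Qed.

Lemma continuous_tuple_ext n (x : T) :
  continuous (fun u : {ptws 'I_n -> T} => tuple_ext u x).
Proof.
apply: continuous_ptws => i; rewrite /tuple_ext.
case: unliftP => [j _|_]; first exact: (@proj_continuous _ (fun=> T)).
exact: cst_continuous.
Qed.

Variable B : nat -> set T.
Hypothesis Bb : countable_base B.

(** A fibre that is somewhere dense has a basic set [B i] in its closure. The tuples for which this
    happens with a given [i] lie in a closed set [H i]; an open [U] inside [H i] would put the open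
    box over [U] and [B i] into the closure of [F]. *)
Lemma nowhere_dense_fibers n (F : set {ptws 'I_n.+1 -> T}) :
  nowhere_dense F ->
  meagre [set u : {ptws 'I_n -> T} |
          ~ nowhere_dense [set x | F (tuple_ext u x)]].
Proof.
move=> F0.
(* For empty [B i] the condition would hold vacuously for every tuple, hence the default [set0]. *)
pose H i : set {ptws 'I_n -> T} :=
  if pselect (B i !=set0) then
    [set u | forall x, B i x -> closure F (tuple_ext u x)] else set0.
have Hcl i : closed (H i).
  rewrite /H; case: pselect => [Bi|nBi]; last exact: closed0.
  have -> : [set u : {ptws 'I_n -> T} |
             forall x, B i x -> closure F (tuple_ext u x)] =
      \bigcap_(x in B i) [set u | closure F (tuple_ext u x)].
    by apply/seteqP; split=> u.
  apply: closed_bigI => x _; apply: (continuous_closedP _).1 (closure F) _.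
    exact: continuous_tuple_ext.
  exact: closed_closure.
have : meagre (\bigcup_i H i).
  apply: meagre_bigcup => i; apply/nowhere_dense_meagre/nowhere_denseP.
  move=> U oU [u0 Uu0]; apply: contrapT => h.
  have UH u : U u -> H i u.
    by move=> Uu; apply: contrapT => nHu; apply: h; exists u => // /Hcl.
  have : H i u0 by exact: UH.
  rewrite /H; case: pselect => [[b Bib] _|nBi []].
  pose r (v : {ptws 'I_n.+1 -> T}) : {ptws 'I_n -> T} :=
    fun j => v (lift ord_max j).
  have cr : continuous r.
    by apply: continuous_ptws => j; exact: (@proj_continuous _ (fun=> T)).
  have cm : continuous (fun v : {ptws 'I_n.+1 -> T} => v ord_max).
    exact: (@proj_continuous _ (fun=> T)).
  have [||v [Uv Bv]] := (nowhere_denseP F).1 F0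
      (r @^-1` U `&` (fun v => v ord_max) @^-1` B i).
  - apply: openI; first by move/continuousP: cr; apply.
    by move/continuousP: cm; apply; exact: Bb.1.
  - exists (tuple_ext u0 b); split => /=; last by rewrite tuple_ext_max.
    suff -> : r (tuple_ext u0 b) = u0 by [].
    by apply/funext => j; rewrite /r tuple_ext_lift.
  apply; have := UH _ Uv; rewrite /H; case: pselect => [Bi|nBi []].
  by move=> /(_ _ Bv); rewrite -tuple_ext_cases.
apply: meagreS => u nd.
have [U [oU [x Ux] UF]] : exists U, [/\ open U, U !=set0 &
    forall x, U x -> closure [set x | F (tuple_ext u x)] x].
  apply: contrapT => h; apply: nd; apply/nowhere_denseP => U oU U0.
  apply: contrapT => h'; apply: h; exists U; split=> // x Ux.
  by apply: contrapT => ?; apply: h'; exists x.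
have [i [Bix BU]] := Bb.2 _ _ oU Ux.
exists i => //; rewrite /H; case: pselect => [Bi|[]]; last by exists x.
move=> y /BU /UF cy W nW.
have ce : continuous (fun x => tuple_ext u x).
  apply: continuous_ptws => j; rewrite /tuple_ext.
  by case: unliftP => [k _|_] z; [exact: cst_continuous|exact: cvg_id].
by have [z [Fz Wz]] := cy _ (ce y _ nW); exists (tuple_ext u z).
Qed.

Lemma kuratowski_ulam n (S : set {ptws 'I_n.+1 -> T}) : comeagre S ->
  comeagre [set u : {ptws 'I_n -> T} | comeagre [set x | S (tuple_ext u x)]].
Proof.
move=> [F [F0 SF]].
have : meagre (\bigcup_i [set u : {ptws 'I_n -> T} |
    ~ nowhere_dense [set x | F i (tuple_ext u x)]]).
  by apply: meagre_bigcup => i; exact: nowhere_dense_fibers.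
apply: meagreS => u nu; apply: contrapT => h; apply: nu.
exists (fun i => [set x | F i (tuple_ext u x)]); split => [i|x /SF[i _ Fi]].
  by apply: contrapT => ?; apply: h; exists i.
by exists i.
Qed.

Lemma comeagre_bigcap (X : topologicalType) (F : nat -> set X) :
  (forall i, comeagre (F i)) -> comeagre (\bigcap_i F i).
Proof. by move=> Fc; rewrite /comeagre setC_bigcap; exact: meagre_bigcup. Qed.

(** Each stage [P j.+1] keeps the tuples of [P j] almost all of whose extensions are in [P j]. In
    the intersection of all stages, stage [j.+1] for a tuple controls stage [j] for its
    extensions. *)
Lemma hereditarily_generic (O : forall n, set {ptws 'I_n -> T}) :
  (forall n, comeagre (O n)) ->
  exists Q : forall n, set {ptws 'I_n -> T},
    [/\ forall n, Q n `<=` O n, forall n, comeagre (Q n) &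
        forall n u, Q n u -> comeagre [set x | Q n.+1 (tuple_ext u x)]].
Proof.
move=> Oc.
pose P := fix P (j : nat) : forall n, set {ptws 'I_n -> T} :=
  if j is j'.+1 then fun n => P j' n `&`
    [set u | comeagre [set x | P j' n.+1 (tuple_ext u x)]]
  else O.
have Pc j : forall n, comeagre (P j n).
  elim: j => [//|j IH] n; rewrite /comeagre /= setCI; apply: meagreU.
    exact: IH.
  exact/kuratowski_ulam/IH.
exists (fun n => \bigcap_j P j n); split.
- by move=> n u /(_ 0%N); apply.
- by move=> n; exact: comeagre_bigcap.
move=> n u Qu.
have -> : [set x | (\bigcap_j P j n.+1) (tuple_ext u x)] =
    \bigcap_j [set x | P j n.+1 (tuple_ext u x)] by apply/seteqP; split=> x.
by apply: comeagre_bigcap => j; have [] := Qu j.+1 I.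
Qed.

End Extension.

(** * Algebra and continuity in a topometric group *)

Section TopometricGroup.
Variables (G : topologicalType) (mul : G -> G -> G) (inv : G -> G) (one : G).
Variable d : G -> G -> R.
Hypothesis topometric : polish_topometric_group mul inv one d.
Local Infix "∙" := mul (at level 40, left associativity).

Definition conjg (k x : G) : G := k ∙ x ∙ inv k.

Lemma mulA x y z : x ∙ (y ∙ z) = x ∙ y ∙ z.
Proof. by case: topometric => -[[[+ _ _] _] _] _ _ _ _; apply. Qed.

Lemma mul1 x : one ∙ x = x.
Proof. by case: topometric => -[[[_ /(_ x)[h _] _] _] _]. Qed.

Lemma mulr1 x : x ∙ one = x.
Proof. by case: topometric => -[[[_ /(_ x)[_ h] _] _] _]. Qed.

Lemma mulV x : inv x ∙ x = one.
Proof. by case: topometric => -[[[_ _ /(_ x)[h _]] _] _]. Qed.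

Lemma mulrV x : x ∙ inv x = one.
Proof. by case: topometric => -[[[_ _ /(_ x)[_ h]] _] _]. Qed.

Lemma mulK x y : inv x ∙ (x ∙ y) = y.
Proof. by rewrite mulA mulV mul1. Qed.

Lemma mulVK x y : x ∙ (inv x ∙ y) = y.
Proof. by rewrite mulA mulrV mul1. Qed.

Lemma inv_eq x y : x ∙ y = one -> inv x = y.
Proof. by move=> xy; rewrite -[inv x]mulr1 -xy mulK. Qed.

Lemma invM x y : inv (x ∙ y) = inv y ∙ inv x.
Proof. by apply: inv_eq; rewrite -mulA mulVK mulrV. Qed.

Lemma invK x : inv (inv x) = x.
Proof. by apply: inv_eq; rewrite mulV. Qed.

Lemma conjgM k l x : conjg (k ∙ l) x = conjg k (conjg l x).
Proof. by rewrite /conjg invM !mulA. Qed.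

Lemma conjgK k x : conjg (inv k) (conjg k x) = x.
Proof. by rewrite -conjgM mulV /conjg mul1 (inv_eq (mul1 one)) mulr1. Qed.

Lemma mul_continuous : continuous (fun p : G * G => p.1 ∙ p.2).
Proof. by case: topometric => -[[_ [h _]] _]. Qed.

Lemma inv_continuous : continuous inv.
Proof. by case: topometric => -[[_ [_ h]] _]. Qed.

Lemma mulf_continuous (S : topologicalType) (f h : S -> G) :
  continuous f -> continuous h -> continuous (fun s => f s ∙ h s).
Proof.
move=> cf ch s.
apply: (@continuous_comp _ _ _ (fun s => (f s, h s)) (fun p => p.1 ∙ p.2)).
  exact: cvg_pair (cf s) (ch s).
exact: mul_continuous.
Qed.

Lemma invf_continuous (S : topologicalType) (f : S -> G) :
  continuous f -> continuous (fun s => inv (f s)).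
Proof. by move=> cf s; apply: (continuous_comp (cf s)); exact: inv_continuous. Qed.

Lemma conjf_continuous (S : topologicalType) (f h : S -> G) :
  continuous f -> continuous h -> continuous (fun s => conjg (f s) (h s)).
Proof.
move=> cf ch; apply: mulf_continuous; last exact: invf_continuous.
exact: mulf_continuous.
Qed.

Lemma idf_continuous (S : topologicalType) : continuous (fun x : S => x).
Proof. by move=> x; exact: cvg_id. Qed.

Lemma mull_continuous g : continuous (fun x => g ∙ x).
Proof.
apply: mulf_continuous; [exact: cst_continuous|exact: idf_continuous].
Qed.

Lemma mulr_continuous g : continuous (fun x => x ∙ g).
Proof.
apply: mulf_continuous; [exact: idf_continuous|exact: cst_continuous].
Qed.

Lemma dist_xx x : d x x = 0.
Proof. by case: topometric => _ [_ /(_ x x)[_ h] _ _] _ _ _; exact: h. Qed.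

Lemma dist_sym x y : d x y = d y x.
Proof. by case: topometric => _ []. Qed.

Lemma dist_tri x y z : d x z <= d x y + d y z.
Proof. by case: topometric => _ []. Qed.

Lemma dist_mull g x y : d (g ∙ x) (g ∙ y) = d x y.
Proof. by case: topometric => _ _ /(_ g x y)[h _]. Qed.

Lemma dist_mulr g x y : d (x ∙ g) (y ∙ g) = d x y.
Proof. by case: topometric => _ _ /(_ g x y)[_ h]. Qed.

Lemma dist_conj k x y : d (conjg k x) (conjg k y) = d x y.
Proof. by rewrite dist_mulr dist_mull. Qed.

(** Lower semicontinuity of [d], pulled back along a pair of continuous maps; it carries bounds on
    [d] to limits in the group topology. *)
Lemma closed_dist_le (S : topologicalType) (f h : S -> G) (r : R) :
  continuous f -> continuous h -> closed [set s | d (f s) (h s) <= r].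
Proof.
move=> cf ch; case: topometric => _ _ _ _ /(_ r).
apply: (continuous_closedP (fun s => (f s, h s))).1.
by move=> s; exact: cvg_pair (cf s) (ch s).
Qed.

(** * Generic tuples and the tree of conjugators *)

Variables (rho : G -> G -> R) (q : nat -> G) (B : nat -> set G).
Hypotheses (rhoP : complete_metric_for rho) (qd : dense_sequence q)
  (Bb : countable_base B).

(* The sets [S i] of those [x] for which [tuple_ext u x] is near a conjugate of
   [z] by some [v ∙ q i], [v] close to [one], cover almost every [x]; one of
   them is nonmeagre in [O], hence comeagre in an open [U], being a projection
   of a closed set.  It thus contains points of [X] and of [Y], and their
   conjugators differ by an element of [V]. *)
Lemma conjugating_extension n (u : {ptws 'I_n -> G}) (z : 'I_n.+1 -> G)
    (e : R) (O X Y M V : set G) :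
  comeagre [set x |
    fatten (@sup_metric G d n.+1) (conj_orbit mul inv z) e (tuple_ext u x)] ->
  open O -> O !=set0 -> O `<=` nonmeagre_points X ->
  O `<=` nonmeagre_points Y -> meagre M -> nbhs one V ->
  exists x y f, [/\ X x /\ ~ M x, Y y /\ ~ M y, V f &
    forall i, d (conjg f (tuple_ext u y i)) (tuple_ext u x i) <= 2 * e].
Proof.
move=> gen oO O0 OX OY mM nV.
have [r r0 rV] : exists2 r : R, 0 < r &
    forall v w, rho one v <= r -> rho one w <= r -> V (v ∙ inv w).
  have cdiv : continuous (fun p : G * G => p.1 ∙ inv p.2).
    apply: mulf_continuous; first by move=> p; exact: cvg_fst.
    by apply: invf_continuous => p; exact: cvg_snd.
  have [] := cdiv (one, one) V.
    by rewrite /= mulrV.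
  move=> [V1 V2] /= [n1 n2] V12.
  have [_ rho_nbhs _] := rhoP.
  have [r r0 rV] := (rho_nbhs one (V1 `&` V2)).1 (filterI n1 n2).
  (* Halving allows the closed ball, which keeps the relation [C i] below closed. *)
  exists (r / 2); first by rewrite divr_gt0.
  move=> v w hv hw; apply: (V12 (v, w)); split => /=.
    by have [] : (V1 `&` V2) v by apply: rV => /=; lra.
  by have [] : (V1 `&` V2) w by apply: rV => /=; lra.
pose C i v x := rho one v <= r /\
  forall j, d (conjg (v ∙ q i) (z j)) (tuple_ext u x j) <= e.
pose S i := [set x | exists v, C i v x].
have cC i : closed [set vx : G * G | C i vx.1 vx.2].
  have -> : [set vx : G * G | C i vx.1 vx.2] =
      ((fun vx => vx.1) @^-1` [set v | rho one v <= r]) `&`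
      \bigcap_j [set vx : G * G |
        d (conjg (vx.1 ∙ q i) (z j)) (tuple_ext u vx.2 j) <= e].
    by apply/seteqP; split=> vx [h1 h2]; split=> // j; [move=> _|]; exact: h2.
  apply: closedI.
    apply: (continuous_closedP _).1; first by move=> p; exact: cvg_fst.
    exact: closed_metric_ball.
  apply: closed_bigI => j _; apply: closed_dist_le.
    apply: conjf_continuous; last exact: cst_continuous.
    apply: mulf_continuous; last exact: cst_continuous.
    by move=> p; exact: cvg_fst.
  rewrite /tuple_ext; case: unliftP => [k _|_]; first exact: cst_continuous.
  by move=> p; exact: cvg_snd.
have Snik i : meagre (nonmeagre_points (S i) `\` S i).
  exact: (projection_nonmeagre_points rhoP qd Bb (cC i)).
have cover : meagre (~` \bigcup_i S i).
  apply: meagreS gen => x nS [_ [k ->] hk]; apply: nS.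
  (* By density some [q i] makes [v = k ∙ inv (q i)] close to [one], and then [v ∙ q i = k]. *)
  have oW : open [set w | rho one (k ∙ inv w) < r].
    have /continuousP h := mulf_continuous (@cst_continuous _ _ k)
      (invf_continuous (@idf_continuous G)).
    exact: (h _ (@open_metric_ball _ _ rhoP one r)).
  have [|i /= ri] := qd oW.
    exists k; rewrite /= mulrV; have [[_ h _ _] _ _] := rhoP.
    by rewrite (h one one).2.
  exists i => //; exists (k ∙ inv (q i)); split; first exact: ltW.
  move=> j; rewrite -mulA mulV mulr1 dist_sym.
  apply: le_trans (ltW hk).
  exact: (le_bigmax _ (fun j => d (tuple_ext u x j) (conjg k (z j))) j).
have [i nmi] : exists i, ~ meagre (S i `&` O).
  apply: contrapT => h; apply: (baire_category rhoP oO O0).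
  have : meagre ((\bigcup_i (S i `&` O)) `|` ~` \bigcup_i S i).
    apply: meagreU => //; apply: meagre_bigcup => i.
    by apply: contrapT => ?; apply: h; exists i.
  apply: meagreS => x Ox; have [[i _ Six]|] := pselect ((\bigcup_i S i) x).
    by left; exists i.
  by right.
(* [S i] is nonmeagre at every point of [U], so by [Snik] it contains almost all of [U]. *)
pose U := (nonmeagre_points (S i `&` O))° `&` O.
have oU : open U by apply: openI => //; exact: open_interior.
have U0 : U !=set0.
  have [w Nw] := nonmeagre_interior Bb nmi.
  have nw := interior_subset Nw.
  (* If the interior missed [O], the trace of [S i ∩ O] on it would be empty. *)
  apply: contrapT => h; apply: (nw _ (@open_interior _ _) Nw).
  suff -> : S i `&` O `&` (nonmeagre_points (S i `&` O))° = set0 by exact: meagre0.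
  by rewrite -subset0 => x [[_ Ox] Nx]; apply: h; exists x.
have mM' : meagre (M `|` (nonmeagre_points (S i) `\` S i)) by exact: meagreU.
have pick (Z : set G) : O `<=` nonmeagre_points Z ->
    exists x, [/\ Z x, ~ M x & S i x].
  move=> OZ; have [x [Nx Ox] [Zx nMx]] :=
    nonmeagre_diff (fun x (Ux : U x) => OZ x Ux.2) oU U0 mM'.
  exists x; split=> //; first by move=> Mx; apply: nMx; left.
  apply: contrapT => nSx; apply: nMx; right; split=> //.
  by apply: nonmeagre_pointsS (interior_subset Nx); exact: subIsetl.
have [x [Xx nMx [v [rv hv]]]] := pick _ OX.
have [y [Yy nMy [w [rw hw]]]] := pick _ OY.
exists x, y, (v ∙ inv w); split=> //; first exact: rV.
move=> j; apply: le_trans (dist_tri _ (conjg (v ∙ q i) (z j)) _) _.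
have -> : conjg (v ∙ q i) (z j) = conjg (v ∙ inv w) (conjg (w ∙ q i) (z j)).
  by rewrite -conjgM -!mulA mulK.
rewrite dist_conj dist_sym.
have := hv j; have := hw j.
by rewrite -[conjg (v ∙ inv w) _]conjgM -!mulA mulK; lra.
Qed.

(** Intersecting over the tolerances [2^-m] gives one comeagre set that serves every [e]; only [z]
    still depends on [e]. *)
Lemma generic_orbits n : ample_generics mul inv d ->
  exists On : set {ptws 'I_n -> G}, comeagre On /\
    forall e : R, 0 < e -> exists z : 'I_n -> G,
      On `<=` fatten (@sup_metric G d n) (conj_orbit mul inv z) e.
Proof.
move=> ag; have /choice[z zP] := fun m : nat =>
  ag n (2^-1 ^+ m) (exprn_gt0 m (ltac:(by rewrite invr_gt0) : 0 < 2^-1 :> R)).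
exists (\bigcap_m (fatten (@sup_metric G d n) (conj_orbit mul inv (z m))
                      (2^-1 ^+ m))); split; first exact: comeagre_bigcap.
move=> e e0; have [m hm] := exprn_half_lt e0.
exists (z m) => u /(_ m I)[v ov uv]; exists v => //.
exact: lt_trans uv hm.
Qed.

(* Each [a : nat -> bool] codes a limit [h a] of products of conjugators: at
   step [n] the bit [a n] decides whether an element of [Y] or one of [X] is
   appended to the generic tuple, the two resulting tuples being nearly
   conjugate; later conjugators nearly fix the tuple.  Hence, if [a] and [b]
   first differ at [n], then [h a] and [h b] carry the elements chosen at step
   [n] near each other.  Two distinct codes have limits in one [k i ∙ W]. *)
Lemma nearly_conjugate (O X Y W : set G) (k : nat -> G) (e : R) :
  ample_generics mul inv d ->
  open O -> O !=set0 -> O `<=` nonmeagre_points X ->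
  O `<=` nonmeagre_points Y ->
  (forall h, exists i, exists2 w, W w & h = k i ∙ w) -> 0 < e ->
  exists x y v w, [/\ X x, Y y, W v, W w & d (conjg v x) (conjg w y) < e].
Proof.
move=> ag oO O0 OX OY kW e0.
have [[_ rho0 _ _] rho_nbhs _] := rhoP.
pose On n := projT1 (cid (generic_orbits n ag)).
have OnP n := projT2 (cid (generic_orbits n ag)).
have [Q [QO Qc Qext]] := hereditarily_generic Bb (fun n => (OnP n).1).
(* The tolerances from step [n] on sum to [e / 3 * 2^-n]. *)
pose eta n : R := e / 3 * 2^-1 ^+ n.+1.
have eta0 n : 0 < eta n by rewrite mulr_gt0 ?divr_gt0 // exprn_gt0 // invr_gt0.
pose state := {n : nat & ({ptws 'I_n -> G} * G)%type}.
have step (s : state) : exists t : G * G * G, let: (x, y, f) := t in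
    Q (tag s) (tagged s).1 ->
    [/\ X x /\ Q _ (tuple_ext (tagged s).1 x),
        Y y /\ Q _ (tuple_ext (tagged s).1 y),
        rho (tagged s).2 ((tagged s).2 ∙ f) < 2^-1 ^+ tag s &
        forall i, d (conjg f (tuple_ext (tagged s).1 y i))
                    (tuple_ext (tagged s).1 x i) <= eta (tag s)].
  case: s => n [u p] /=.
  have [Qu|nQ] := pselect (Q n u); last by exists (one, one, one).
  have [eta2 eta20 eta2E] : exists2 r : R, 0 < r & 2 * r = eta n.
    by exists (eta n / 2); rewrite ?divr_gt0 // mulrC divfK.
  have [z Oz] := (OnP n.+1).2 eta2 eta20.
  have [||x [y [f [[Xx Qx] [Yy Qy] Vf hf]]]] :=
      @conjugating_extension n u z eta2 O X Y
        (~` [set x | Q n.+1 (tuple_ext u x)]) [set f | rho p (p ∙ f) < 2^-1 ^+ n]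
        _ oO O0 OX OY (Qext n u Qu).
  - by apply: meagreS (Qext n u Qu) => x nf Qx; apply/nf/Oz/QO.
  - apply: open_nbhs_nbhs; split.
      have /continuousP h := @mull_continuous p.
      exact: (h _ (@open_metric_ball _ _ rhoP p _)).
    by rewrite /= mulr1 (rho0 p p).2 // exprn_gt0.
  exists (x, y, f) => _; split=> //; first by split=> //; exact: contrapT.
    by split=> //; exact: contrapT.
  by move=> i; rewrite -eta2E; exact: hf.
have [F FP] := choice step.
(* A state is a generic tuple with the product of conjugators so far. The new [f] is multiplied on
   the right, so it acts on the tuple first, and only where the bit is true. *)
pose st (a : nat -> bool) := fix st n : {ptws 'I_n -> G} * G :=
  if n is n'.+1 return ({ptws 'I_n -> G} * G)%type then
    let: (x, y, f) := F (existT _ n' (st n')) in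
    if a n' then (tuple_ext (st n').1 y, (st n').2 ∙ f)
    else (tuple_ext (st n').1 x, (st n').2)
  else (fun=> one, one).
have Q0 u : Q 0%N u by exact: ptws0_comeagre (Qc 0%N).
have stQ a n : Q n (st a n).1.
  elim: n => [|n IH]; first exact: Q0.
  have := FP (existT _ n (st a n)) => /=.
  case: (F _) => -[x y] f /(_ IH)[[_ Qx] [_ Qy] _ _].
  by case: (a n).
have st_rho a n : rho (st a n).2 (st a n.+1).2 < 2^-1 ^+ n.
  have := FP (existT _ n (st a n)) => /=.
  case: (F _) => -[x y] f /(_ (stQ a n))[_ _ hf _].
  by case: (a n) => //=; rewrite (rho0 _ _).2 // exprn_gt0.
(* The two extensions agree on old coordinates, so [f] moves these by at most [eta n]. *)
have st_step a n i : (exists j, (st a n.+1).1 j = (st a n).1 i) /\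
    d (conjg (st a n.+1).2 ((st a n).1 i)) (conjg (st a n).2 ((st a n).1 i))
      <= eta n.
  have := FP (existT _ n (st a n)) => /=.
  case: (F _) => -[x y] f /(_ (stQ a n))[_ _ _ hf].
  split.
    exists (lift ord_max i).
    by case: (a n) => /=; rewrite tuple_ext_lift.
  case: (a n) => /=; last by rewrite dist_xx ltW.
  rewrite conjgM dist_conj.
  by have := hf (lift ord_max i); rewrite !tuple_ext_lift.
have /choice[h hP] : forall a, exists l : G, (fun n => (st a n).2) @ \oo --> l.
  by move=> a; apply: (geometric_cvg rhoP); exact: st_rho.
(* The bound is the telescoped sum of [eta] from [n] to [n + m - 1]; the index [j] tracks the old
   coordinate in the longer tuple. *)
have st_tail a n i m : (exists j, (st a (n + m)%N).1 j = (st a n).1 i) /\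
    d (conjg (st a (n + m)%N).2 ((st a n).1 i))
      (conjg (st a n).2 ((st a n).1 i))
      <= e / 3 * (2^-1 ^+ n - 2^-1 ^+ (n + m)).
  elim: m => [|m [[j hj] IH]].
    rewrite addn0 subrr mulr0 dist_xx; split => //.
    by exists i.
  have [[j' hj'] hd] := st_step a (n + m)%N j.
  rewrite addnS; split; first by exists j'; rewrite hj' hj.
  move: hd; rewrite hj /eta exprS => hd.
  have := dist_tri (conjg (st a (n + m).+1).2 ((st a n).1 i))
    (conjg (st a (n + m)%N).2 ((st a n).1 i)) (conjg (st a n).2 ((st a n).1 i)).
  lra.
have h_near a n i : d (conjg (h a) ((st a n).1 i))
    (conjg (st a n).2 ((st a n).1 i)) <= e / 3 * 2^-1 ^+ n.
  set w := (st a n).1 i; set c := conjg (st a n).2 _.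
  have cl : closed [set g | d (conjg g w) c <= e / 3 * 2^-1 ^+ n].
    apply: closed_dist_le; last exact: cst_continuous.
    apply: conjf_continuous; [exact: idf_continuous|exact: cst_continuous].
  apply: (closed_cvg _ cl _ _ (hP a)).
  exists n => // m /= nm; have := (st_tail a n i (m - n)%N).2.
  rewrite subnKC // -/w -/c => /le_trans; apply.
  have h0 : 0 <= 2^-1 ^+ m :> R by apply: exprn_ge0.
  by apply: ler_wpM2l; [rewrite divr_ge0 // ltW|rewrite lerBlDr lerDl].
(* With [p] the common product at step [n], conjugating [x] by [h a] is close to conjugating it by
   [p], then to conjugating [y] by [p ∙ f], then by [h b]. Each of the three errors is at most
   [e / 6]. The common factor [k i] cancels. *)
have diff a b n i v w : (forall m, (m < n)%N -> a m = b m) ->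
    a n = false -> b n = true -> W v -> W w ->
    h a = k i ∙ v -> h b = k i ∙ w ->
    exists x y v w, [/\ X x, Y y, W v, W w & d (conjg v x) (conjg w y) < e].
  move=> ab an bn Wv Ww ha hb.
  have st_ab : st a n = st b n.
    elim: n ab {an bn} => [//|n IH] ab /=.
    rewrite IH ?ab // => m mn; apply: ab.
    exact: ltnW.
  have := FP (existT _ n (st a n)) => /=.
  have sa : st a n.+1 = let: (x, y, f) := F (existT _ n (st a n)) in
    (tuple_ext (st a n).1 x, (st a n).2) by rewrite /= an.
  have sb : st b n.+1 = let: (x, y, f) := F (existT _ n (st a n)) in
    (tuple_ext (st a n).1 y, (st a n).2 ∙ f) by rewrite /= bn -st_ab.
  move: sa sb; case: (F _) => -[x y] f sa sb.
  move=> /(_ (stQ a n))[[Xx _] [Yy _] _ /(_ ord_max)].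
  rewrite !tuple_ext_max => hf.
  exists x, y, v, w; split=> //.
  have := h_near a n.+1 ord_max; have := h_near b n.+1 ord_max.
  rewrite sa sb /= !tuple_ext_max conjgM ha hb !conjgM => hy hx.
  rewrite -(dist_conj (k i)).
  rewrite dist_sym in hy; rewrite dist_sym -(dist_conj (st a n).2) in hf.
  apply: le_lt_trans (dist_tri _ (conjg (st a n).2 x) _) _.
  have := dist_tri (conjg (st a n).2 x) (conjg (st a n).2 (conjg f y))
    (conjg (k i) (conjg w y)).
  have : e / 3 * 2^-1 ^+ n.+1 <= e / 3 * 2^-1.
    apply: ler_wpM2l; first by rewrite divr_ge0 // ltW.
    exact: (@exprn_half_le 1 n.+1).
  by rewrite /eta in hf; lra.
have /choice[iv ivP] : forall a, exists iv : nat * G,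
    W iv.2 /\ h a = k iv.1 ∙ iv.2.
  by move=> a; have [i [w Ww hw]] := kW (h a); exists (i, w).
have [a [b [iab nab]]] : exists a b, (iv a).1 = (iv b).1 /\ a <> b.
  apply: contrapT => nh.
  have inj a b : (iv a).1 = (iv b).1 -> a = b.
    by move=> hab; apply: contrapT => ?; apply: nh; exists a, b.
  (* Cantor's diagonal argument: were the index injective on branches, [c] would have no consistent
     value at its own index. *)
  pose c n := `[< forall a, (iv a).1 = n -> a n = false >].
  have [ct|cf] := boolP (c (iv c).1).
    by have /asboolP/(_ c erefl) := ct; rewrite ct.
  by move/asboolP: (cf); apply => a /inj ->; exact: negbTE.
have exn : exists n, a n != b n.
  apply: contrapT => nh; apply: nab; apply/funext => n.
  by apply: contrapT => /eqP ?; apply: nh; exists n.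
have [n abn nmin] := ex_minnP exn.
have ab m : (m < n)%N -> a m = b m.
  by move=> mn; apply: contraTeq mn => /nmin; rewrite -leqNgt.
have [[Wa ha] [Wb hb]] := (ivP a, ivP b).
move: abn; case an: (a n); case bn: (b n) => // _.
  apply: (diff b a n (iv b).1 (iv b).2 (iv a).2) => //; last by rewrite -iab.
  by move=> m /ab.
by apply: (diff a b n (iv a).1 (iv a).2 (iv b).2) => //; rewrite iab.
Qed.

Lemma nonmeagre_points_translate (A : set G) g x :
  nonmeagre_points A (inv g ∙ x) ->
  nonmeagre_points [set y | A (inv g ∙ y)] x.
Proof.
move=> Nx U oU Ux mU.
have oU' : open [set y | U (g ∙ y)].
  by have /continuousP h := @mull_continuous g; exact: h.
apply: (Nx _ oU'); first by rewrite /= mulVK.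
have := meagre_preimage (@mull_continuous g) (@mull_continuous (inv g))
  (mulVK g) (mulK g) mU.
by apply: meagreS => y /= [Ay Uy]; rewrite mulK.
Qed.

(** Otherwise countably many meagre translates would cover the group, against Baire. *)
Lemma sigma_syndetic_nonmeagre (A : set G) :
  sigma_syndetic mul A -> ~ meagre A.
Proof.
move=> [k kA] mA; apply: (baire_category rhoP openT); first by exists one.
have : meagre (\bigcup_i [set x | A (inv (k i) ∙ x)]).
  apply: meagre_bigcup => i.
  exact: meagre_preimage (@mull_continuous _) (@mull_continuous (k i))
    (mulK (k i)) (mulVK (k i)) mA.
apply: meagreS => x _; have [i [a Aa ->]] := kA x.
by exists i => //; rewrite /= mulK.
Qed.

End TopometricGroup.

(** * The Steinhaus property *)

Lemma setpowS (G : Type) (mul : G -> G -> G) (one : G) (A : set G) n x a :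
  setpow mul one A n x -> A a -> setpow mul one A n.+1 (mul x a).
Proof. by move=> Ax Aa; exists x, a. Qed.

Unset Implicit Arguments.

Theorem theorem4p5 (G : topologicalType)
    (mul : G -> G -> G) (inv : G -> G) (one : G) (d : G -> G -> R) :
  polish_topometric_group mul inv one d ->
  ample_generics mul inv d ->
  forall A : set G, symmetric_set inv A -> sigma_syndetic mul A ->
  forall eps : R, 0 < eps ->
    (fatten d (setpow mul one A 10) eps)° one.
Proof.
move=> topo ample A symA synA eps eps0.
have [[_ [[D [cD dD]] [rho rhoP]]] _ _ _ _] := topo.
have [q qd] := countable_dense_sequence one cD dD.
have [B Bb] := dense_sequence_countable_base rhoP qd.
have [c Oc] := nonmeagre_interior Bb (sigma_syndetic_nonmeagre topo rhoP synA).
set O := (nonmeagre_points A)° in Oc.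
have openO : open O by exact: open_interior.
have openOt h : open [set x | O (mul h x)].
  by have /continuousP C := @mull_continuous _ _ _ _ _ topo h; exact: C.
(* For such [g] the point [mul g c] lies in [O] and in its translate by [g], so that these meet. *)
have nbhs1 : nbhs one [set g | O (mul g c)].
  apply: open_nbhs_nbhs; split; last by rewrite /= (mul1 topo).
  by have /continuousP C := @mulr_continuous _ _ _ _ _ topo c; exact: C.
apply: filterS nbhs1 => g Ogc.
have [k kA] := synA.
have [x [y [v [w [Ax Ay Av Aw vw]]]]] : exists x y v w,
    [/\ A x, A (mul (inv g) y), A v, A w &
        d (conjg mul inv v x) (conjg mul inv w y) < eps].
  apply: (nearly_conjugate topo rhoP qd Bb
    (O := O `&` [set x | O (mul (inv g) x)])
    (Y := [set y | A (mul (inv g) y)]) ample _ _ _ _ kA eps0).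
  - by apply: openI => //; exact: openOt.
  - by exists (mul g c); split=> //=; rewrite (mulK topo).
  - by move=> z [/interior_subset].
  - move=> z [_ /interior_subset]; exact: (nonmeagre_points_translate topo).
have Ai z : A z -> A (inv z) by move/(symA z).
set a := mul (inv g) y in Ay.
(* Six factors matter: [inv w], [v], [x], [inv v], [w], [inv a]. Since [setpow] counts factors
   exactly and [one] need not be in [A], two pairs [v], [inv v] pad the product to ten. *)
pose t := mul (mul (mul (mul (mul (mul (mul (mul (mul (mul one v) (inv v)) v)
  (inv v)) (inv w)) v) x) (inv v)) w) (inv a).
exists t; first by do 10 (apply: setpowS; last by auto).
have tE : t = mul (conjg mul inv (mul (inv w) v) x) (inv a).
  by rewrite /t /conjg (mul1 topo) (invM topo) (invK topo) -!(mulA topo)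
    !(mulVK topo).
have gE : g = mul y (inv a).
  by rewrite /a (invM topo) (invK topo) (mulVK topo).
(* Cancelling [inv a] and conjugating by [w] turns the distance from [g] to [t] into the one bounded
   in [vw]. *)
rewrite {1}gE tE (dist_mulr topo) (dist_sym topo) (conjgM topo).
by rewrite -(conjgK topo w y) (dist_conj topo).
Qed.
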